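(* For each $n$, let $K_n$ be the complete graph on the vertex set $V=\{1,2,\ldots,n\}$, let $p(f)=p_n(f)\in[0,1]$ for each edge $f$ of $K_n$, let $X_f$, $f\in K_n$, be independent Bernoulli random variables with $\mathbb{P}(X_f=1)=p(f)=1-\mathbb{P}(X_f=0)$, and let $G$ be the random subgraph of $K_n$ on $V$ formed by all edges $f$ with $X_f=1$. Suppose there are constants $0\le\beta_{up}\le\beta_{low}\le\alpha$ and positive constants $C_1,C_2$ such that $$\frac{C_1}{n^{\beta_{low}}}\le\frac{1}{\binom{l}{2}}\sum_{u,v\in\mathcal{V}}p(u,v)\le\frac{C_2}{n^{\beta_{up}}}$$ for any set $\mathcal{V}\subseteq V$ containing $l\ge n^{\alpha}(\log n)^3$ vertices. Then there are positive constants $D_2,D_3,D_4$ such that $$\mathbb{P}\left(\chi(G)\ge\frac{n^{1-\alpha}}{(\log n)^3}\right)\ge 1-\exp\left(-D_2\, n^{2\alpha-\beta_{low}}(\log n)^6\right)$$ and $$\mathbb{P}\left(\chi(G)\le D_3\, n^{\max(\alpha,1-\beta_{up})}(\log n)^4\right)\ge 1-\exp\left(-D_4\, n^{2\alpha-\beta_{low}}(\log n)^5\right)$$ for all $n$ large.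
   Context: $\chi(G)$ denotes the chromatic number of $G$. Here $p(u,v)$ is the probability of the edge with endvertices $u$ and $v$, and the sum over $u,v\in\mathcal{V}$ is over unordered pairs of distinct vertices, so that the displayed quantity is the average edge probability over the $\binom{l}{2}$ edges with both endvertices in $\mathcal{V}$. Constants do not depend on $n$. *)

(* Defs.v *)
From HB Require Import structures.
From mathcomp Require Import all_boot all_order all_algebra.
From mathcomp Require Import all_classical all_reals all_analysis.

Set Implicit Arguments.
Unset Strict Implicit.
Unset Printing Implicit Defensive.

Import Order.TTheory GRing.Theory Num.Theory.

Local Open Scope classical_set_scope.
Local Open Scope ring_scope.

(* Edges of the complete graph on T, i.e. unordered pairs of distinct vertices.
   A simple graph on T is represented by its edge set, of type {set edge T}. *)
Definition edge (T : finType) := {e : {set T} | #|e| == 2}.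
HB.instance Definition _ (T : finType) := SubFinite.on (edge T).

Definition adjacent (T : finType) (G : {set edge T}) : rel T :=
  fun u v => [exists e in G, val e == [set u; v]%SET].

Definition colorable (T : finType) (G : {set edge T}) (k : nat) : bool :=
  [exists c : {ffun T -> 'I_k}, forall u, forall v,
     adjacent G u v ==> (c u != c v)].

Lemma ex_colorable (T : finType) (G : {set edge T}) :
  exists k, colorable G k.
Proof.
exists #|T|; apply/existsP; exists [ffun u => enum_rank u].
apply/forallP => u; apply/forallP => v; apply/implyP => /existsP[e /andP[_]].
rewrite !ffunE (inj_eq enum_rank_inj) => /eqP euv.
by have := valP e; rewrite /= euv cards2; case: (u != v).
Qed.

Definition chromatic_number (T : finType) (G : {set edge T}) : nat :=
  ex_minn (ex_colorable G).

Definition mutually_independent d (Omega : measurableType d) (R : realType)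
    (P : probability Omega R) d' (S : measurableType d') (I : finType)
    (X : I -> {RV P >-> S}) : Prop :=
  forall (J : {set I}) (B : I -> set S), (forall i, measurable (B i)) ->
    P (\bigcap_(i in [set` J]) (X i @^-1` B i)) =
    (\prod_(i in J) P (X i @^-1` B i))%E.

Definition edge_avg (R : realType) (T : finType) (p : edge T -> R)
    (A : {set T}) : R :=
  (\sum_(e : edge T | val e \subset A) p e) / 'C(#|A|, 2)%:R.

Definition random_graph d (Omega : measurableType d) (R : realType)
    (P : probability Omega R) (T : finType)
    (X : edge T -> {RV P >-> bool}) (w : Omega) : {set edge T} :=
  [set e | X e w]%SET.

(* Main.v *)
Require Import Defs.
From mathcomp Require Import all_boot all_order all_algebra.
From mathcomp Require Import all_classical all_reals all_analysis.
From mathcomp Require Import zify ring lra.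

Import Order.TTheory GRing.Theory Num.Theory.
Local Open Scope classical_set_scope.
Local Open Scope ring_scope.

(* Let L = n^alpha (log n)^3 and c = C1 / n^beta_low.  A fixed set A of at
   least L vertices is independent in G with probability at most
   exp(-c 'C(|A|, 2)), and by Chernoff's bound the same holds for the event that
   A spans at least e C2 n^(-beta_up) 'C(|A|, 2) edges.  Since c L is at least a
   constant times (log n)^3, this beats the union bound over all such A.
   If no large set is independent, colour classes have fewer than L vertices,
   hence chi(G) >= n / L.  If no large set is dense, every vertex set spans a
   subgraph with a vertex of degree at most L + e C2 n^(1 - beta_up), and a
   greedy colouring of this degenerate graph gives the upper bound. *)

(** * Colour classes, degeneracy and minimum degree *)

Definition inner_edges {T : finType} (A : {set T}) : {set edge T} :=
  [set e : edge T | val e \subset A]%SET.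

Definition neighbors {T : finType} (G : {set edge T}) (A : {set T}) (v : T) :
  {set T} := [set u in A | Defs.adjacent G v u]%SET.

Lemma adjacent_sym {T : finType} (G : {set edge T}) : symmetric (Defs.adjacent G).
Proof. by move=> u v; apply: eq_existsb => e; rewrite finset.setUC. Qed.

Lemma adjacent_irr {T : finType} (G : {set edge T}) : irreflexive (Defs.adjacent G).
Proof.
move=> u; apply/existsP => -[e /andP[_ /eqP eE]].
by have := valP e; rewrite eE finset.setUid cards1.
Qed.

Lemma chromatic_colorable {T : finType} (G : {set edge T}) :
  colorable G (chromatic_number G).
Proof. by rewrite /chromatic_number; case: ex_minnP. Qed.

Lemma chromatic_number_le {T : finType} (G : {set edge T}) k :
  colorable G k -> (chromatic_number G <= k)%N.
Proof. by rewrite /chromatic_number; case: ex_minnP => m _; apply. Qed.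

(** In an optimal colouring the classes partition [T] and none of them spans an edge of [G], so the
    bound [L] applies to every class. *)
Lemma card_le_chromatic {R : realType} {T : finType} (G : {set edge T}) (L : R) :
  (forall A : {set T}, (G :&: inner_edges A)%SET == finset.set0 -> #|A|%:R <= L) ->
  #|T|%:R <= (chromatic_number G)%:R * L.
Proof.
move=> indep_le; have /existsP[c /forallP col] := chromatic_colorable G.
have -> : #|T| = (\sum_i #|[set u | c u == i]%SET|)%N.
  rewrite -sum1_card (partition_big c xpredT) //=.
  by apply: eq_bigr => i _; rewrite -sum1_card; apply: eq_bigl => u; rewrite inE.
rewrite natr_sum mulr_natl -[X in _ *+ X]card_ord -sumr_const.
apply: ler_sum => i _; apply: indep_le.
rewrite finset.setI_eq0 finset.disjoints_subset; apply/fintype.subsetP => e eG.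
rewrite !inE; apply/negP => /fintype.subsetP eA.
have /cards2P[u [v [uv eE]]] := valP e.
have /eqP cu : c u == i by have := eA u; rewrite eE !inE eqxx; apply.
have /eqP cv : c v == i by have := eA v; rewrite eE !inE eqxx orbT; apply.
have /forallP /(_ v) := col u; rewrite cu cv eqxx implybF => /negP; apply.
by apply/existsP; exists e; rewrite eG eE /=.
Qed.

Lemma degenerate_colorable {T : finType} (G : {set edge T}) k :
  (forall A : {set T}, A != finset.set0 ->
     exists2 v, v \in A & (#|neighbors G A v| <= k)%N) ->
  colorable G k.+1.
Proof.
move=> deg.
(* The induction runs over vertex sets, with colourings proper only inside [A]: delete a vertex of
   degree at most [k], colour the rest, and give the vertex a colour that its neighbours miss. *)
suff : forall m (A : {set T}), (#|A| <= m)%N -> exists c : {ffun T -> 'I_k.+1},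
    {in A &, forall u v, Defs.adjacent G u v -> c u != c v}.
  case/(_ #|T| finset.setT); first exact: max_card.
  move=> c colc; apply/existsP; exists c; apply/forallP => u; apply/forallP => v.
  by apply/implyP; apply: colc; rewrite inE.
elim=> [|m IH] A.
  rewrite leqn0 cards_eq0 => /eqP->.
  by exists [ffun=> ord0] => u v; rewrite inE.
have [->|A0 Am] := eqVneq A finset.set0.
  by exists [ffun=> ord0] => u v; rewrite inE.
have [v vA degv] := deg A A0.
have [|c colc] := IH (A :\ v)%SET; first by rewrite (cardsD1 v A) vA in Am.
have : ~~ ([set: 'I_k.+1]%SET \subset [set c u | u in neighbors G A v]%SET).
  apply/negP => /subset_leq_card; rewrite cardsT card_ord.
  by move=> /leq_trans/(_ (leq_imset_card _ _))/leq_trans/(_ degv); rewrite ltnn.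
move=> /fintype.subsetPn[x _ xN].
have cN u : u \in A -> Defs.adjacent G v u -> x != c u.
  move=> uA vu; apply: contraNneq xN => ->.
  by apply: imset_f; rewrite inE uA.
exists [ffun u => if u == v then x else c u] => u w uA wA uw; rewrite !ffunE.
case: (eqVneq u v) (eqVneq w v) => [uv|uv] [wv|wv].
- by move: uw; rewrite uv wv adjacent_irr.
- by apply: cN => //; rewrite -uv.
- by rewrite eq_sym; apply: cN => //; rewrite adjacent_sym -wv.
- by apply: colc => //; rewrite !inE ?uv ?wv.
Qed.

Lemma card_neighbors_le {T : finType} {G : {set edge T}} {A : {set T}} {v : T} :
  v \in A ->
  (#|neighbors G A v| <= #|[set e in G :&: inner_edges A | v \in val e]%SET|)%N.
Proof.
move=> vA; rewrite -(card_imset _ val_inj).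
rewrite -(card_in_imset (f := fun u => [set v; u]%SET)).
  apply/subset_leq_card/fintype.subsetP => B /imsetP[u]; rewrite inE => /andP[uA].
  case/existsP => e /andP[eG /eqP eE] ->; rewrite -eE imset_f // !inE eG eE.
  by rewrite !inE eqxx finset.subUset !finset.sub1set vA uA.
move=> u w; rewrite !inE => /andP[_ vu] _ /finset.setP /(_ u).
rewrite !inE eqxx orbT => /esym/orP[/eqP uv|/eqP //].
by move: vu; rewrite uv adjacent_irr.
Qed.

(** Double counting of incidences: an edge of [G] inside [A] has two endpoints. *)
Lemma sum_neighbors_le {T : finType} (G : {set edge T}) (A : {set T}) :
  (\sum_(v in A) #|neighbors G A v| <= 2 * #|(G :&: inner_edges A)%SET|)%N.
Proof.
apply: (@leq_trans
  (\sum_(v in A) \sum_(e in (G :&: inner_edges A)%SET) (v \in val e))%N).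
  apply: leq_sum => v vA; apply: leq_trans (card_neighbors_le vA) _.
  rewrite -sum1_card big_mkcond [leqRHS]big_mkcond /=; apply: leq_sum => e _.
  by rewrite [in X in (X <= _)%N]inE; case: (e \in _); case: (v \in _).
rewrite exchange_big /= mulnC -sum_nat_const; apply: leq_sum => e _.
rewrite -[leqRHS](eqP (valP e)) -sum1_card big_mkcond [leqRHS]big_mkcond /=.
by apply: leq_sum => v _; case: (v \in A); case: (v \in _).
Qed.

Lemma min_degree {T : finType} (G : {set edge T}) (A : {set T}) :
  A != finset.set0 -> exists2 v, v \in A &
    (#|neighbors G A v| * #|A| <= 2 * #|(G :&: inner_edges A)%SET|)%N.
Proof.
case/finset.set0Pn => v0 v0A.
case: (arg_minnP (fun v => #|neighbors G A v|) v0A) => v vA vmin.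
exists v => //; apply: leq_trans (sum_neighbors_le _ _).
by rewrite mulnC -sum_nat_const; apply: leq_sum.
Qed.

(** * Product weights on graphs and their tails *)

Lemma sum_set_prod {R : comNzRingType} {I : finType} (f g : I -> R) :
  \sum_(H : {set I}) \prod_i (if i \in H then f i else g i) = \prod_i (f i + g i).
Proof.
under [RHS]eq_bigr => i _ do rewrite -(big_bool _ (fun b => if b then f i else g i)).
rewrite bigA_distr_bigA (reindex (fun H : {set I} => [ffun i => i \in H])) /=.
  by apply: eq_bigr => H _; apply: eq_bigr => i _; rewrite ffunE.
exists (fun h : {ffun I -> bool} => [set i | h i]%SET) => [H _|h _].
  by apply/finset.setP => i; rewrite inE ffunE.
by apply/ffunP => i; rewrite ffunE inE.
Qed.

(** The probability that independent edges form exactly [H]; with these finite weights all tail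
    estimates are made without reference to [Omega]. *)
Definition graph_prob {R : realType} {T : finType} (p : edge T -> R)
  (H : {set edge T}) : R :=
  \prod_e (if e \in H then p e else 1 - p e).

Lemma graph_prob_ge0 {R : realType} {T : finType} (p : edge T -> R)
  (p01 : forall e, 0 <= p e <= 1) H :
  0 <= graph_prob p H.
Proof.
apply: prodr_ge0 => e _; case/andP: (p01 e) => p0 p1.
by case: ifP => // _; rewrite subr_ge0.
Qed.

Lemma sum_graph_prob {R : realType} {T : finType} (p : edge T -> R) :
  \sum_H graph_prob p H = 1.
Proof. by rewrite sum_set_prod big1 // => e _; rewrite addrC subrK. Qed.

(** The generating function of the number of edges inside [A] factors over edges into terms
    [1 + (t - 1) * p e], or 1 outside [A], and [1 + x <= expR x] bounds each of them. *)
Lemma graph_generating_le {R : realType} {T : finType} (p : edge T -> R)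
  (p01 : forall e, 0 <= p e <= 1) (A : {set T}) (t : R) :
  0 <= t ->
  \sum_H graph_prob p H * t ^+ #|(H :&: inner_edges A)%SET| <=
  expR ((t - 1) * \sum_(e : edge T | val e \subset A) p e).
Proof.
move=> t0; have -> : \sum_H graph_prob p H * t ^+ #|(H :&: inner_edges A)%SET| =
    \prod_(e : edge T) ((if val e \subset A then p e * t else p e) + (1 - p e)).
  rewrite -sum_set_prod; apply: eq_bigr => H _.
  have -> : t ^+ #|(H :&: inner_edges A)%SET| =
      \prod_e (if e \in (H :&: inner_edges A)%SET then t else 1).
    by rewrite -big_mkcond /= prodr_const.
  rewrite -big_split /=; apply: eq_bigr => e _; rewrite !inE.
  by case: (e \in H); case: (val e \subset A); rewrite //= mulr1.
rewrite mulr_sumr expR_sum [leRHS]big_mkcond /=; apply: ler_prod => e _.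
case/andP: (p01 e) => p0 p1; case: ifP => _; last by rewrite addrC subrK ler01 lexx.
apply/andP; split; first by rewrite addr_ge0 ?mulr_ge0 ?subr_ge0.
apply: le_trans (expR_ge1Dx _); lra.
Qed.

(** At [t = 0] the generating function is the weight of the graphs with no edge inside [A], because
    [0 ^+ 0 = 1]. *)
Lemma empty_tail {R : realType} {T : finType} (p : edge T -> R)
  (p01 : forall e, 0 <= p e <= 1) (A : {set T}) :
  \sum_(H | (H :&: inner_edges A)%SET == finset.set0) graph_prob p H <=
  expR (- \sum_(e : edge T | val e \subset A) p e).
Proof.
rewrite -[X in expR X]mulN1r -(sub0r 1).
apply: le_trans (graph_generating_le _ p01 A 0 (lexx _)).
rewrite big_mkcond /=; apply: ler_sum => H _.
rewrite -cards_eq0 expr0n.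
by case: ifP => _; rewrite ?mulr1 ?mulr0 ?lexx.
Qed.

(** Markov's inequality for the generating function at [t = expR 1]. *)
Lemma upper_tail {R : realType} {T : finType} (p : edge T -> R)
  (p01 : forall e, 0 <= p e <= 1) (A : {set T}) (s : R) :
  \sum_(H | s <= #|(H :&: inner_edges A)%SET|%:R) graph_prob p H <=
  expR ((expR 1 - 1) * (\sum_(e : edge T | val e \subset A) p e) - s).
Proof.
rewrite expRD.
apply: le_trans (ler_wpM2r _ (graph_generating_le _ p01 A (expR 1) _));
  rewrite ?expR_ge0 // big_distrl /= big_mkcond /=; apply: ler_sum => H _.
case: ifP => sH; last first.
  by rewrite !mulr_ge0 ?(graph_prob_ge0 _ p01) ?exprn_ge0 ?expR_ge0.
rewrite -mulrA ler_peMr ?(graph_prob_ge0 _ p01) // -expRM_natl mulr1 -expRD.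
by rewrite -[leLHS]expR0 ler_expR subr_ge0.
Qed.


(** * Transfer from finite weights to the probability space *)

Lemma prob_random_graph {d} {Omega : measurableType d} {R : realType}
    {P : probability Omega R} {T : finType} (p : edge T -> R)
    (X : edge T -> {RV P >-> bool}) :
  (forall e, 0 <= p e <= 1) ->
  (forall e, distribution P (X e) = bernoulli_prob (p e)
     :> (set bool -> \bar R)) ->
  mutually_independent X ->
  forall Q : pred {set edge T},
  P [set w | Q (random_graph X w)] = (\sum_(H | Q H) graph_prob p H)%:E.
Proof.
move=> p01 Xp Xindep Q.
have eventE H : [set w | random_graph X w = H] =
    \bigcap_(e in [set` finset.setT]) (X e @^-1` [set e \in H]).
  apply/seteqP; split => [w /= <- e _|w XH] /=; first by rewrite inE.
  by apply/finset.setP => e; rewrite inE; apply: XH; rewrite /= inE.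
have measX e b : measurable (X e @^-1` [set b]).
  by rewrite -[X in measurable X]setTI; exact: (measurable_funP (X e)).
have measE H : measurable [set w | random_graph X w = H].
  by rewrite eventE; apply: fin_bigcap_measurable.
have -> : [set w | Q (random_graph X w)] =
    \bigcup_(H in [set` Q]) [set w | random_graph X w = H].
  by apply/seteqP; split => [w Qw|w [H QH /= ->]] //; exists (random_graph X w).
rewrite measure_fin_bigcup //; last first.
  by move=> H H' _ _ [w [/= <- <-]].
rewrite -(@bigfs _ _ _ _ (index_enum _)) ?index_enum_uniq //; last first.
  by move=> H _; rewrite mem_index_enum.
rewrite -sumEFin; apply: eq_bigr => H _.
(* Independence over the full edge set turns the event that the graph equals [H] into a product with
   one factor per edge. *)
rewrite eventE; apply: etrans (Xindep finset.setT (fun e => [set e \in H]) _) _ => //.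
rewrite -prodEFin; apply: eq_big => [e|e _]; first by rewrite inE.
have <- : distribution P (X e) [set e \in H] = P (X e @^-1` [set e \in H]) by [].
rewrite Xp bernoulli_probE // !diracE.
have memb (b b' : bool) : (b \in [set b']) = (b == b').
  by apply/idP/eqP; rewrite inE.
by rewrite !memb; case: (e \in H); rewrite mule1 mule0 ?adde0 ?add0e.
Qed.

(** The graphs outside [Q] all lie in [Bad], so their weight is at most [x]. *)
Lemma prob_random_graph_ge {d} {Omega : measurableType d} {R : realType}
    {P : probability Omega R} {T : finType} (p : edge T -> R)
    (X : edge T -> {RV P >-> bool}) :
  (forall e, 0 <= p e <= 1) ->
  (forall e, distribution P (X e) = bernoulli_prob (p e)
     :> (set bool -> \bar R)) ->
  mutually_independent X ->
  forall (Q Bad : pred {set edge T}) (x : R),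
  (forall H, ~~ Bad H -> Q H) -> \sum_(H | Bad H) graph_prob p H <= x ->
  ((1 - x)%:E <= P [set w | Q (random_graph X w)])%E.
Proof.
move=> p01 Xp Xindep Q Bad x BadQ badx.
rewrite (prob_random_graph _ _ p01 Xp Xindep) lee_fin lerBlDr.
rewrite -(sum_graph_prob p) (bigID Q) /= lerD2l; apply: le_trans badx.
rewrite big_mkcond [leRHS]big_mkcond; apply: ler_sum => H _.
have := graph_prob_ge0 _ p01 H; case: ifPn => [nQ|_]; last by case: ifP.
by case: ifPn (BadQ H) => // _ /(_ isT) QH; rewrite QH in nQ.
Qed.

(** * Union bound over large vertex sets *)

(* The factor |T|^-|A| is summable: by the binomial theorem its sum over all A
   is (1 + 1/|T|)^|T| <= e. *)
Lemma union_bound {R : realType} {T : finType} (p : edge T -> R)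
    (p01 : forall e, 0 <= p e <= 1) (big : pred {set T})
    (bad : {set T} -> pred {set edge T}) (K : R) : (0 < #|T|)%N ->
  (forall A, big A ->
     \sum_(H | bad A H) graph_prob p H <= expR (- K - 1) / #|T|%:R ^+ #|A|) ->
  \sum_(H | [exists A, big A && bad A H]) graph_prob p H <= expR (- K).
Proof.
move=> T0 badK.
pose gp A H := if big A && bad A H then graph_prob p H else 0.
apply: (@le_trans _ _ (\sum_H \sum_A gp A H)).
  rewrite big_mkcond; apply: ler_sum => H _ /=.
  have gp0 A : 0 <= gp A H by rewrite /gp; case: ifP; rewrite ?graph_prob_ge0.
  case: ifPn => [/existsP[A HA]|_]; last exact: sumr_ge0.
  rewrite (bigD1 A) //= {1}/gp HA lerDl; exact: sumr_ge0.
rewrite exchange_big /=.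
apply: (@le_trans _ _ (\sum_(A : {set T}) expR (- K - 1) / #|T|%:R ^+ #|A|)).
  apply: ler_sum => A _; rewrite -big_mkcond /=.
  have [bigA|_] := boolP (big A); first exact: badK.
  by rewrite big_pred0_eq divr_ge0 ?expR_ge0 ?exprn_ge0.
have -> : \sum_(A : {set T}) expR (- K - 1) / #|T|%:R ^+ #|A| =
    expR (- K - 1) * \prod_(i : T) (#|T|%:R^-1 + 1).
  rewrite -sum_set_prod mulr_sumr; apply: eq_bigr => A _; congr (_ * _).
  by rewrite -big_mkcond prodr_const exprVn.
rewrite prodr_const expRD -mulrA ler_piMr ?expR_ge0 // mulrC.
rewrite expRN ler_pdivrMr ?expR_gt0 // mul1r.
have -> : expR 1 = expR (#|T|%:R^-1 : R) ^+ #|T|.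
  by rewrite -expRM_natl divff // pnatr_eq0 -lt0n.
apply: lerXn2r; rewrite ?nnegrE ?addr_ge0 ?expR_ge0 ?invr_ge0 //.
by rewrite addrC expR_ge1Dx.
Qed.

Lemma mul_bin2 l : ('C(l, 2) * 2 = l * l.-1)%N.
Proof.
elim: l => // l IH; rewrite binS bin1 mulnDl IH /=.
by case: l {IH} => // l /=; lia.
Qed.

Lemma bin2_ge {R : realFieldType} l :
  (2 <= l)%N -> l%:R ^+ 2 / 4 <= 'C(l, 2)%:R :> R.
Proof.
move=> l2; rewrite ler_pdivrMr // -natrX -natrM ler_nat.
have := mul_bin2 l; nia.
Qed.

Lemma bin2_le {R : realFieldType} l : 'C(l, 2)%:R <= l%:R ^+ 2 / 2 :> R.
Proof.
by rewrite ler_pdivlMr // -natrX -natrM ler_nat mul_bin2 -mulnn leq_mul // leq_pred.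
Qed.

(** With l = [#|A|], the exponent is at least c l^2 / 4. One half of this covers [c * L ^+ 2 / 8];
    the other is at least 2 l ln |T|, by the factor 16 in the hypothesis, and pays for the summable
    factor and the extra 1 in [union_bound]. *)
Lemma large_sets_bound {R : realType} {T : finType} (p : edge T -> R)
    (p01 : forall e, 0 <= p e <= 1) (bad : {set T} -> pred {set edge T})
    (c L : R) : 0 < c -> 2 <= L -> 1 <= ln #|T|%:R :> R ->
  16 * ln #|T|%:R <= c * L ->
  (forall A : {set T}, L <= #|A|%:R ->
     \sum_(H | bad A H) graph_prob p H <= expR (- (c * 'C(#|A|, 2)%:R))) ->
  \sum_(H | [exists A : {set T}, (L <= #|A|%:R) && bad A H]) graph_prob p H
    <= expR (- (c * L ^+ 2 / 8)).
Proof.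
move=> c0 L2 lnT1 cL badc.
(* As [ln 0 = 0], the bound [1 <= ln #|T|%:R] rules out an empty [T]. *)
have T0 : (0 < #|T|)%N by case: #|T| lnT1 => // ; rewrite ln0 // ler10.
apply: (union_bound _ p01 (fun A : {set T} => L <= #|A|%:R)) => // A LA.
apply: le_trans (badc A LA) _.
have -> : #|T|%:R = expR (ln #|T|%:R) :> R by rewrite lnK // posrE ltr0n.
rewrite -expRM_natl -expRN -expRD ler_expR.
have A2 : (2 <= #|A|)%N by rewrite -(ler_nat R) (le_trans L2).
have := bin2_ge (R := R) _ A2; set C := 'C(_, _)%:R => leC.
have lelam : 1 <= #|A|%:R * ln #|T|%:R :> R.
  by rewrite mulr_ege1 // (le_trans _ (le_trans L2 LA)) // ler1n.
have : c * (#|A|%:R ^+ 2 / 4) <= c * C by rewrite ler_wpM2l // ltW.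
have : #|A|%:R * (16 * ln #|T|%:R) <= #|A|%:R * (c * #|A|%:R) :> R.
  by rewrite ler_wpM2l // (le_trans cL) // ler_wpM2l // ltW.
have : c * L ^+ 2 <= c * #|A|%:R ^+ 2.
  by rewrite ler_wpM2l ?(ltW c0) // ler_pXn2r // nnegrE; lra.
rewrite expr2; lra.
Qed.

(** * Colouring graphs without dense large sets *)

(** A set of at least [L] vertices has a vertex of degree at most [x * #|A|%:R] inside it, and in a
    smaller set all degrees are below [L]; the sum of both bounds serves either case, and degeneracy
    costs one more colour. *)
Lemma sparse_chromatic_le {R : realType} {T : finType} (G : {set edge T})
    (L x : R) : 0 <= L -> 0 <= x ->
  (forall A : {set T}, L <= #|A|%:R ->
     #|(G :&: inner_edges A)%SET|%:R <= x * #|A|%:R ^+ 2 / 2) ->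
  (chromatic_number G)%:R <= L + x * #|T|%:R + 1.
Proof.
move=> L0 x0 sparse.
have d0 : 0 <= L + x * #|T|%:R by rewrite addr_ge0 ?mulr_ge0.
suff : (chromatic_number G <= (Num.truncn (L + x * #|T|%:R)).+1)%N.
  rewrite -(ler_nat R) => /le_trans; apply.
  by rewrite -natr1 lerD2r truncn_le.
apply/chromatic_number_le/degenerate_colorable => A A0.
have [v vA degv] := min_degree G A A0.
exists v => //; rewrite truncn_ge_nat //.
have xA : x * #|A|%:R <= x * #|T|%:R by rewrite ler_wpM2l ?ler_nat ?max_card.
have [LA|AL] := leP L #|A|%:R.
  have a0 : 0 < #|A|%:R :> R by rewrite ltr0n card_gt0.
  suff : #|neighbors G A v|%:R <= x * #|A|%:R by lra.
  rewrite -(ler_pM2r a0) -natrM; move: degv; rewrite -(ler_nat R) natrM.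
  have := sparse A LA; rewrite expr2; lra.
suff : #|neighbors G A v|%:R <= #|A|%:R :> R.
  by have := mulr_ge0 x0 (ler0n R #|T|); lra.
rewrite ler_nat subset_leq_card //; apply/fintype.subsetP => u.
by rewrite inE => /andP[].
Qed.

(** * Choice of constants and the two probability bounds *)

Theorem theorem2 (R : realType)
    (d : nat -> measure_display) (Omega : forall n, measurableType (d n))
    (P : forall n, probability (Omega n) R)
    (p : forall n, edge 'I_n -> R)
    (X : forall n, edge 'I_n -> {RV (P n) >-> bool})
    (alpha beta_up beta_low C1 C2 : R)
    (p01 : forall n (f : edge 'I_n), 0 <= p n f <= 1)
    (Xp : forall n (f : edge 'I_n),
       distribution (P n) (X n f) = bernoulli_prob (p n f)
         :> (set bool -> \bar R))
    (Xindep : forall n, mutually_independent (X n))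
    (beta_up_ge0 : 0 <= beta_up)
    (beta_up_low : beta_up <= beta_low)
    (beta_low_alpha : beta_low <= alpha)
    (C1_gt0 : 0 < C1) (C2_gt0 : 0 < C2)
    (avg_bounds : forall n (A : {set 'I_n}),
       (2 <= #|A|)%N ->
       n%:R `^ alpha * ln n%:R ^+ 3 <= #|A|%:R ->
       C1 / n%:R `^ beta_low <= edge_avg (p n) A <= C2 / n%:R `^ beta_up) :
  exists D2 D3 D4 : R, [/\ 0 < D2, 0 < D3, 0 < D4 &
    \forall n \near \oo,
      ((1 - expR (- (D2 * n%:R `^ (2 * alpha - beta_low) * ln n%:R ^+ 6)))%:E
         <= P n [set w | (n%:R `^ (1 - alpha) / ln n%:R ^+ 3
                          <= (chromatic_number (random_graph (X n) w))%:R :> R)%R])%E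
      /\
      ((1 - expR (- (D4 * n%:R `^ (2 * alpha - beta_low) * ln n%:R ^+ 5)))%:E
         <= P n [set w | ((chromatic_number (random_graph (X n) w))%:R
                          <= D3 * n%:R `^ Num.max alpha (1 - beta_up)
                               * ln n%:R ^+ 4 :> R)%R])%E].
Proof.
(* [C1 / 8] comes from the exponent [c * L ^+ 2 / 8] with [c = C1 / b]. In the second witness one
   unit pays for [L], one for the additional colour, and [expR 1 * C2] for the degree term. *)
exists (C1 / 8), (2 + expR 1 * C2), (C1 / 8).
have e0 := expR_gt0 (1 : R); have eC0 : 0 < expR 1 * C2 by rewrite mulr_gt0.
split; [by rewrite divr_gt0 | lra | by rewrite divr_gt0 |].
near=> n.
(* [2 <= lam] yields [2 <= L], so [avg_bounds] covers every set of at least [L] vertices;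
   [16 / C1 <= lam] yields the factor 16 of the union bound. *)
have large_lam : Num.max 2 (16 / C1) <= ln n%:R :> R.
  rewrite -(expRK (Num.max _ _)) ler_ln ?posrE ?expR_gt0 //; last first.
    apply: (lt_le_trans (expR_gt0 (Num.max 2 (16 / C1)))).
    by near: n; exact: nbhs_infty_ger.
  by near: n; exact: nbhs_infty_ger.
set lam := ln n%:R in large_lam *.
move: large_lam; rewrite ge_max => /andP[lam2 lamC1].
have n0 : 0 < n%:R :> R.
  by rewrite ltNge; apply/negP => /ln0 lam0; move: lam2; rewrite /lam lam0; lra.
have n1 : 1 <= n%:R :> R by rewrite ler1n -(ltr0n R).
have n1' : n%:R != 0 :> R by rewrite gt_eqF.
pose a := n%:R `^ alpha : R; pose b := n%:R `^ beta_low : R.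
pose u := n%:R `^ beta_up : R; pose L := a * lam ^+ 3.
have b1 : 1 <= b by rewrite -(powRr0 n%:R) ler_powR //; lra.
have ba : b <= a by rewrite ler_powR.
have u0 : 0 < u by rewrite powR_gt0.
have b0 : 0 < b by lra.
have a0 : 0 < a by lra.
have lam3 : lam <= lam ^+ 3 by rewrite exprSr ler_peMl ?exprn_ege1; lra.
have L2 : 2 <= L by rewrite /L; nra.
pose c := C1 / b.
have c0 : 0 < c by rewrite divr_gt0.
(* Here [beta_low <= alpha] enters: since [b <= a], [c * L] is at least [C1 * lam ^+ 3]. *)
have cL : 16 * lam <= c * L.
  have C1lam : 16 <= C1 * lam by move: lamC1; rewrite ler_pdivrMr // mulrC.
  have cb : c * b = C1 by rewrite /c divfK // gt_eqF.
  have : c * b * lam ^+ 3 <= c * L.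
    by rewrite -mulrA ler_pM2l // ler_pM2r // exprn_gt0; lra.
  rewrite cb; apply: le_trans; rewrite exprS mulrA expr2; nra.
have expE : C1 / 8 * n%:R `^ (2 * alpha - beta_low) * lam ^+ 6 = c * L ^+ 2 / 8.
  rewrite powRB ?n1' ?implybT // mulr_natl mulr2n powRD ?n1' ?implybT //.
  by rewrite -/a -/b /c /L; field; rewrite gt_eqF.
have avgP (A : {set 'I_n}) : L <= #|A|%:R ->
    c * 'C(#|A|, 2)%:R <= \sum_(e : edge 'I_n | val e \subset A) p n e
      <= C2 / u * 'C(#|A|, 2)%:R.
  move=> LA; have A2 : (2 <= #|A|)%N by rewrite -(ler_nat R) (le_trans L2).
  have := avg_bounds n A A2 LA; rewrite /edge_avg.
  by rewrite ler_pdivlMr ?ler_pdivrMr // ltr0n bin_gt0.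
have lnT : ln #|'I_n|%:R = lam :> R by rewrite card_ord.
pose empty_on (A : {set 'I_n}) : pred {set edge 'I_n} :=
  fun H => (H :&: inner_edges A)%SET == finset.set0.
pose dense_on (A : {set 'I_n}) : pred {set edge 'I_n} :=
  fun H => expR 1 * (C2 / u * 'C(#|A|, 2)%:R) <= #|(H :&: inner_edges A)%SET|%:R.
have empty_rare := large_sets_bound (p n) (p01 n) empty_on c L c0 L2.
have dense_rare := large_sets_bound (p n) (p01 n) dense_on c L c0 L2.
rewrite lnT in empty_rare dense_rare.
split.
  rewrite expE; apply: (prob_random_graph_ge _ _ (p01 n) (Xp n) (Xindep n)
    (fun H => n%:R `^ (1 - alpha) / lam ^+ 3 <= (chromatic_number H)%:R)
    _ _ _ (empty_rare _ cL _)); [ | lra | ].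
    move=> H; rewrite negb_exists => /forallP nempty.
    (* The threshold equals n / [L], so it suffices that independent sets have at most [L]
       vertices. *)
    rewrite powRB ?n1' ?implybT // powRr1 // -mulrA -invfM ler_pdivrMr; last first.
      by rewrite mulr_gt0 // exprn_gt0; lra.
    have := card_le_chromatic H L; rewrite card_ord; apply=> A HA.
    rewrite leNgt; apply/negP => /ltW LA.
    by have := nempty A; rewrite /empty_on LA HA.
  move=> A LA; apply: le_trans (empty_tail _ (p01 n) A) _.
  by rewrite ler_expR lerN2; case/andP: (avgP A LA).
(* The union bound gives [lam ^+ 6] in the exponent; [lam ^+ 5] follows since [lam >= 1]. *)
have rare : expR (- (c * L ^+ 2 / 8)) <=
    expR (- (C1 / 8 * n%:R `^ (2 * alpha - beta_low) * lam ^+ 5)).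
  rewrite -expE ler_expR lerN2 ler_wpM2l //.
    by rewrite mulr_ge0 ?powR_ge0 // divr_ge0 // ltW.
  by rewrite ler_eXn2l //; lra.
apply: (prob_random_graph_ge _ _ (p01 n) (Xp n) (Xindep n)
    (fun H => (chromatic_number H)%:R <=
       (2 + expR 1 * C2) * n%:R `^ Num.max alpha (1 - beta_up) * lam ^+ 4)
    _ _ _ (le_trans (dense_rare _ cL _) rare)); [ | lra | ].
  move=> H; rewrite negb_exists => /forallP sparse.
  (* This [x] matches the threshold of [dense_on], as 'C(l, 2) <= l^2 / 2. *)
  apply: le_trans (sparse_chromatic_le H L (expR 1 * (C2 / u)) _ _ _) _.
  - lra.
  - by rewrite mulr_ge0 ?divr_ge0 ?ltW.
  - move=> A LA; have := sparse A.
    rewrite /dense_on LA /= -ltNge => /ltW/le_trans; apply.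
    by rewrite -!mulrA !ler_pM2l ?invr_gt0 // mulrA; exact: bin2_le.
  set m := Num.max _ _.
  (* [L], 1 and n / [u] are each at most n^m [lam ^+ 4]: the first by m >= [alpha], the last by m >=
     [1 - beta_up]. *)
  have am : a <= n%:R `^ m by rewrite ler_powR // le_max lexx.
  have um : n%:R / u <= n%:R `^ m.
    rewrite -[X in X / _]powRr1 // -powRB ?n1' ?implybT // ler_powR //.
    by rewrite le_max lexx orbT.
  have lam34 : lam ^+ 3 <= lam ^+ 4.
    by rewrite [leRHS]exprS ler_peMl ?exprn_ge0; lra.
  have lam4 : 1 <= lam ^+ 4 by rewrite exprn_ege1; lra.
  have N4 : n%:R `^ m <= n%:R `^ m * lam ^+ 4 by rewrite ler_peMr ?powR_ge0.
  have LN : L <= n%:R `^ m * lam ^+ 4 by rewrite ler_pM ?exprn_ge0; lra.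
  have uN : expR 1 * C2 * (n%:R / u) <= expR 1 * C2 * (n%:R `^ m * lam ^+ 4).
    by rewrite ler_pM2l //; lra.
  rewrite card_ord (_ : _ * (C2 / u) * _ = expR 1 * C2 * (n%:R / u)); last first.
    by field; rewrite gt_eqF.
  lra.
move=> A LA; apply: le_trans (upper_tail _ (p01 n) A _) _.
(* With M = [C2 / u * 'C(#|A|, 2)%:R], the factor e in [dense_on] makes the exponent at most (e - 1)
   M - e M = -M, and M is at least [c * 'C(#|A|, 2)%:R] by the two average bounds. *)
rewrite ler_expR; case/andP: (avgP A LA) => lo hi.
have : (expR 1 - 1) * (\sum_(e : edge 'I_n | val e \subset A) p n e) <=
    (expR 1 - 1) * (C2 / u * 'C(#|A|, 2)%:R).
  by rewrite ler_wpM2l // subr_ge0; have := expR_ge1Dx (1 : R); lra.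
lra.
Unshelve. all: by end_near.
Qed.
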